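(* A nonnegative matrix $M\in\mathbb{R}_+^{p\times q}$ with $\operatorname{rank}(M)\ge 2$ is a slack matrix of some polytope if and only if $M_{\mathrm{inc}}$ is an incidence matrix of some $(\operatorname{rank}(M)-1)$-dimensional polytope and the all-ones vector $\mathbb{1}\in\mathbb{R}^p$ is contained in the column span of $M$.
   Context: For a polytope $P\subseteq\mathbb{R}^n$ with $\dim(P)\ge 1$, a slack matrix of $P$ is any matrix $S=[\mathbb{1},V]\cdot[w,-W]^T\in\mathbb{R}^{p\times q}$ (so $S_{ij}=w_j-W_jv_i$, with $v_i$ the $i$th row of $V$ and $W_j$ the $j$th row of $W$), where $V\in\mathbb{R}^{p\times n}$ satisfies $P=\operatorname{conv}(\text{rows of }V)$ and $W\in\mathbb{R}^{q\times n}$, $w\in\mathbb{R}^q$ satisfy $P=\{x\in\mathbb{R}^n: Wx\le w\}$. For a matrix $M$, $M_{\mathrm{inc}}$ is the $0/1$-matrix with $(M_{\mathrm{inc}})_{ij}=1$ iff $M_{ij}=0$. An incidence matrix of a polytope $P$ is a matrix $S_{\mathrm{inc}}$ for some slack matrix $S$ of $P$. *)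

(* Defs.v *)
From mathcomp Require Import all_boot all_order all_algebra.
From mathcomp Require Import reals.
Set Implicit Arguments. Unset Strict Implicit. Unset Printing Implicit Defensive.
Import Order.TTheory GRing.Theory Num.Theory.
Local Open Scope ring_scope.

Section Defs.
Variable R : realType.

Definition conv_rows (m n : nat) (V : 'M[R]_(m, n)) : 'rV[R]_n -> Prop :=
  fun x => exists lam : 'rV[R]_m,
    (forall i, 0 <= lam 0 i) /\ \sum_i lam 0 i = 1 /\ x = lam *m V.

Definition hpoly (q n : nat) (W : 'M[R]_(q, n)) (w : 'cV[R]_q) : 'rV[R]_n -> Prop :=
  fun x => forall j, (x *m W^T) 0 j <= w j 0.

Definition is_polytope (n : nat) (P : 'rV[R]_n -> Prop) : Prop :=
  exists m (V : 'M[R]_(m, n)), forall x, P x <-> conv_rows V x.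

(* dim(P) = d : the dimension of the affine hull of P, i.e. the maximal number
   of affinely independent points of P minus one.  For a finite family of
   points (rows of X), rank [1, X] is the number of affinely independent ones. *)
Definition poly_dim (n : nat) (P : 'rV[R]_n -> Prop) (d : nat) : Prop :=
  (exists k (X : 'M[R]_(k, n)),
      (forall i, P (row i X)) /\ \rank (row_mx (const_mx 1%R : 'cV[R]_k) X) = d.+1)
  /\ (forall k (X : 'M[R]_(k, n)),
      (forall i, P (row i X)) -> (\rank (row_mx (const_mx 1%R : 'cV[R]_k) X) <= d.+1)%N).

Definition is_slack_matrix (n : nat) (P : 'rV[R]_n -> Prop) (p q : nat)
    (S : 'M[R]_(p, q)) : Prop :=
  (exists d, (1 <= d)%N /\ poly_dim P d) /\
  exists (V : 'M[R]_(p, n)) (W : 'M[R]_(q, n)) (w : 'cV[R]_q),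
    (forall x, P x <-> conv_rows V x) /\
    (forall x, P x <-> hpoly W w x) /\
    S = row_mx (const_mx 1%R) V *m (row_mx w (- W))^T.

Definition inc_mx (p q : nat) (M : 'M[R]_(p, q)) : 'M[bool]_(p, q) :=
  \matrix_(i, j) (M i j == 0).

Definition is_incidence_of_dim (p q : nat) (B : 'M[bool]_(p, q)) (d : nat) : Prop :=
  exists n (P : 'rV[R]_n -> Prop) (S : 'M[R]_(p, q)),
    is_polytope P /\ poly_dim P d /\ is_slack_matrix P S /\ inc_mx S = B.

Definition is_slack_of_some_polytope (p q : nat) (M : 'M[R]_(p, q)) : Prop :=
  exists n (P : 'rV[R]_n -> Prop), is_polytope P /\ is_slack_matrix P M.

End Defs.

(* Main.v *)
(** Passing to cones, a matrix is a slack matrix essentially when it is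
    "saturated": every nonnegative vector of its row space is a nonnegative
    combination of its rows.  The heart of the proof is that saturation depends
    only on the rank and the zero pattern, by induction on the rank.  Let S be
    saturated and let M have the same zeros and rank.  An irredundant subsystem
    of the columns of S consists of facets, and the rows vanishing in such a
    column form a saturated matrix of rank one less, so the induction hypothesis
    applies to the corresponding rows of M.  Given a nonnegative y in the row
    space of M, subtract the largest multiple of some row of M that keeps y
    nonnegative; the remainder vanishes in a facet column, hence lies in the row
    space of that facet, where it is a nonnegative combination of rows.
    Finally, if M is saturated and M x = 1, a rank factorization normalised so
    that its left factor is [1, V] exhibits M as a slack matrix of conv V. *)

Require Import Defs.
From mathcomp Require Import all_boot all_order all_algebra.
From mathcomp Require Import boolp reals.
Import Order.TTheory GRing.Theory Num.Theory.
Local Open Scope ring_scope.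

Set Implicit Arguments.
Unset Strict Implicit.
Unset Printing Implicit Defensive.

(** * Saturated matrices, their facets, and the transfer of saturation along zero patterns *)

Section ConeSaturation.
Variable R : realType.

Definition row_nonneg (n : nat) (y : 'rV[R]_n) := forall j, 0 <= y 0 j.

Definition cone_saturated (p q : nat) (A : 'M[R]_(p, q)) :=
  forall y : 'rV[R]_q, (y <= A)%MS -> row_nonneg y ->
  exists2 lam : 'rV[R]_p, row_nonneg lam & y = lam *m A.

Definition coord_mask (n : nat) (F : pred 'I_n) : 'M[R]_n :=
  diag_mx (\row_i (F i)%:R).

(* Rows off the face are zeroed rather than deleted, so that faces keep the
   format of the matrix. *)
Definition row_face (p q : nat) (A : 'M[R]_(p, q)) (j : 'I_q) : 'M[R]_(p, q) :=
  coord_mask (fun i => A i j == 0) *m A.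

Definition col_restrict (p q : nat) (A : 'M[R]_(p, q)) (J : {set 'I_q}) :
    'M[R]_(p, q) :=
  A *m coord_mask (fun j => j \in J).

(** The guard [A i j != 0] exempts zero columns, such as those made by [col_restrict]: the whole row
    space vanishes there, so no violator can exist. *)
Definition irredundant_cols (p q : nat) (A : 'M[R]_(p, q)) :=
  forall i j, A i j != 0 ->
  exists y : 'rV[R]_q,
    [/\ (y <= A)%MS, y 0 j < 0 & forall k, k != j -> 0 <= y 0 k].

Lemma row_faceE p q (A : 'M[R]_(p, q)) j i k :
  row_face A j i k = (A i j == 0)%:R * A i k.
Proof. by rewrite /row_face mul_diag_mx !mxE. Qed.

Lemma col_restrictE p q (A : 'M[R]_(p, q)) (J : {set 'I_q}) i k :
  col_restrict A J i k = A i k * (k \in J)%:R.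
Proof. by rewrite /col_restrict mul_mx_diag !mxE. Qed.

Lemma coord_maskE n (F : pred 'I_n) (y : 'rV[R]_n) k :
  (y *m coord_mask F) 0 k = y 0 k * (F k)%:R.
Proof. by rewrite mul_mx_diag !mxE. Qed.

Lemma row_nonneg_mask n (F : pred 'I_n) (y : 'rV[R]_n) :
  row_nonneg y -> row_nonneg (y *m coord_mask F).
Proof. by move=> y0 k; rewrite coord_maskE mulr_ge0 // ler0n. Qed.

Lemma row_face_sub p q (A : 'M[R]_(p, q)) j : (row_face A j <= A)%MS.
Proof. exact: submxMl. Qed.

Lemma row_face_eq0 p q (A : 'M[R]_(p, q)) j (y : 'rV[R]_q) :
  (y <= row_face A j)%MS -> y 0 j = 0.
Proof.
case/submxP => D ->; rewrite mxE big1 // => i _.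
by rewrite row_faceE; case: eqP => [->|_]; rewrite ?mul0r !mulr0.
Qed.

Lemma zero_col_submx p q (A : 'M[R]_(p, q)) j (y : 'rV[R]_q) :
  (y <= A)%MS -> (forall i, A i j = 0) -> y 0 j = 0.
Proof.
by case/submxP => D -> Aj; rewrite mxE big1 // => i _; rewrite Aj mulr0.
Qed.

Lemma row_notin_face p q (A : 'M[R]_(p, q)) i j :
  A i j != 0 -> ~~ (row i A <= row_face A j)%MS.
Proof. by apply: contra => /row_face_eq0; rewrite mxE => ->. Qed.

Lemma rank_row_face_lt p q (A : 'M[R]_(p, q)) i j :
  A i j != 0 -> (\rank (row_face A j) < \rank A)%N.
Proof.
move=> Aij; rewrite ltn_neqAle mxrankS ?row_face_sub // andbT.
apply: contra (row_notin_face Aij) => /eqP e.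
apply: submx_trans (row_sub i A) _.
by rewrite -(geq_leqif (mxrank_leqif_sup (row_face_sub A j))) e.
Qed.

(** Subtracting a multiple of row [i] makes any row vanish at [j], so the face and this single row
    span [A]. *)
Lemma rank_row_face_ge p q (A : 'M[R]_(p, q)) i j :
  A i j != 0 ->
  (forall y : 'rV[R]_q, (y <= A)%MS -> y 0 j = 0 -> (y <= row_face A j)%MS) ->
  (\rank A <= (\rank (row_face A j)).+1)%N.
Proof.
move=> Aij face.
have sub : (A <= row_face A j + row i A)%MS.
  apply/row_subP => k.
  rewrite -(subrK ((A k j / A i j) *: row i A) (row k A)).
  apply: addmx_sub_adds; last exact: scalemx_sub.
  apply: face; last by rewrite !mxE divfK ?subrr.
  by rewrite addmx_sub ?eqmx_opp ?scalemx_sub ?row_sub.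
apply: leq_trans (mxrankS sub) _; apply: leq_trans (mxrank_adds_leqif _ _) _.
by rewrite -[leqRHS]addn1 leq_add2l rank_leq_row.
Qed.

(** A dimension count: adjoining [y] to the face keeps coordinate [j] zero, so row [i] stays outside
    the span and there is no room for the rank to grow. *)
Lemma submx_row_face p q (A : 'M[R]_(p, q)) i j (y : 'rV[R]_q) :
  A i j != 0 -> (\rank A <= (\rank (row_face A j)).+1)%N ->
  (y <= A)%MS -> y 0 j = 0 -> (y <= row_face A j)%MS.
Proof.
move=> Aij rk yA yj.
have subA : (row_face A j + y <= A)%MS by rewrite addsmx_sub row_face_sub.
have rkA : (\rank (row_face A j + y)%MS < \rank A)%N.
  rewrite ltn_neqAle mxrankS // andbT; apply/negP => /eqP e.
  have sAi : (row i A <= row_face A j + y)%MS.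
    apply: submx_trans (row_sub i A) _.
    by rewrite -(geq_leqif (mxrank_leqif_sup subA)) e.
  case/sub_addsmxP: sAi => -[u v] /= e1.
  have uF : (u *m row_face A j) 0 j = 0 by apply/row_face_eq0/submxMl.
  have vy : (v *m y) 0 j = 0 by rewrite mxE big_ord1 yj mulr0.
  have := congr1 (fun z : 'rV[R]_q => z 0 j) e1.
  by rewrite /= mxE [RHS]mxE uF vy addr0; apply/eqP.
have : (\rank (row_face A j + y)%MS <= \rank (row_face A j))%N.
  by rewrite -ltnS; apply: leq_trans rkA rk.
rewrite (geq_leqif (mxrank_leqif_sup (addsmxSl _ _))).
by rewrite addsmx_sub => /andP[].
Qed.

(** A sum of nonnegative terms that is zero at [j] has only zero terms there, so rows off the face
    get coefficient zero. *)
Lemma cone_row_face p q (A : 'M[R]_(p, q)) j (y : 'rV[R]_q) :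
  (forall i k, 0 <= A i k) -> cone_saturated A ->
  (y <= A)%MS -> row_nonneg y -> y 0 j = 0 ->
  exists2 lam : 'rV[R]_p, row_nonneg lam & y = lam *m row_face A j.
Proof.
move=> A0 satA yA y0 yj; have [lam l0 e] := satA y yA y0; exists lam => //.
have: (lam *m A) 0 j == 0 by rewrite -e yj.
rewrite mxE psumr_eq0 => [/allP z|i _]; last exact: mulr_ge0.
rewrite e; apply/rowP => k; rewrite !mxE; apply: eq_bigr => i _.
rewrite row_faceE; have := z i (mem_index_enum i); rewrite /= mulf_eq0.
by case/orP => /eqP ->; rewrite ?eqxx ?mul0r ?mul1r.
Qed.

Lemma cone_saturated_row_face p q (A : 'M[R]_(p, q)) j :
  (forall i k, 0 <= A i k) -> cone_saturated A -> cone_saturated (row_face A j).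
Proof.
move=> A0 satA y yF y0; apply: cone_row_face => //.
- exact: submx_trans yF (row_face_sub _ _).
- exact: row_face_eq0 yF.
Qed.

(* An irredundant column cuts out a facet: a violator of the j-th inequality
   alone, averaged with the sum of all rows, gives a point of the face j that is
   strictly positive elsewhere and can therefore be perturbed freely. *)
Lemma irredundant_facet p q (A : 'M[R]_(p, q)) i j :
  (forall i k, 0 <= A i k) -> cone_saturated A -> irredundant_cols A ->
  A i j != 0 ->
  forall h : 'rV[R]_q, (h <= A)%MS -> h 0 j = 0 -> (h <= row_face A j)%MS.
Proof.
move=> A0 satA irrA Aij h hA hj.
have [y [yA yj yk]] := irrA i j Aij.
pose z : 'rV[R]_q := const_mx 1 *m A.
have zE k : z 0 k = \sum_l A l k.
  by rewrite mxE; apply: eq_bigr => l _; rewrite mxE mul1r.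
have z0 k : 0 <= z 0 k by rewrite zE sumr_ge0.
have zA : (z <= A)%MS by exact: submxMl.
pose u : 'rV[R]_q := z 0 j *: y - y 0 j *: z.
have uA : (u <= A)%MS by rewrite addmx_sub ?eqmx_opp ?scalemx_sub.
have uE k : u 0 k = z 0 j * y 0 k - y 0 j * z 0 k by rewrite !mxE.
have uj : u 0 j = 0 by rewrite uE mulrC subrr.
have u_ge k : k != j -> - y 0 j * z 0 k <= u 0 k.
  by move=> kj; rewrite uE mulNr lerDr mulr_ge0 ?yk.
have u0 : row_nonneg u.
  move=> k; have [->|kj] := eqVneq k j; first by rewrite uj.
  by apply: le_trans (u_ge k kj); rewrite mulr_ge0 // oppr_ge0 ltW.
(* Where [u] vanishes the whole column of [A] is zero, so [h] cannot spoil nonnegativity there. *)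
have hk k : u 0 k = 0 -> h 0 k = 0.
  have [->//|kj] := eqVneq k j => uk.
  apply: (zero_col_submx hA); have: z 0 k == 0.
    rewrite eq_le z0 andbT -(pmulr_rle0 _ (_ : 0 < - y 0 j)) ?oppr_gt0 //.
    by rewrite -uk u_ge.
  rewrite zE psumr_eq0 // => /allP zk l.
  exact/eqP/(zk l (mem_index_enum l)).
(* [T] dominates every ratio, making [T *: u + h] nonnegative; terms with [u 0 k = 0] are zero by
   the convention for division. *)
pose T := \sum_k `|h 0 k| / u 0 k.
have T_ge k : `|h 0 k| / u 0 k <= T.
  by rewrite /T (bigD1 k) //= lerDl sumr_ge0 // => l _; rewrite divr_ge0.
have inF (v : 'rV[R]_q) :
    (v <= A)%MS -> row_nonneg v -> v 0 j = 0 -> (v <= row_face A j)%MS.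
  by move=> vA v0 vj; have [lam _ ->] := cone_row_face A0 satA vA v0 vj;
     exact: submxMl.
have TuE k : (T *: u + h) 0 k = T * u 0 k + h 0 k.
  by rewrite mxE [X in X + _]mxE.
rewrite -(addKr (T *: u) h); apply: addmx_sub.
  by rewrite eqmx_opp scalemx_sub // inF.
apply: inF; first by rewrite addmx_sub ?scalemx_sub.
- move=> k; rewrite TuE.
  have [uk|uk] := eqVneq (u 0 k) 0; first by rewrite uk mulr0 add0r hk.
  apply: le_trans (_ : 0 <= `|h 0 k| + h 0 k) _.
    by rewrite addrC -lerBlDr sub0r lerNnormlW.
  rewrite lerD2r -ler_pdivrMr ?T_ge // lt_def uk; exact: u0.
- by rewrite TuE uj mulr0 add0r.
Qed.

(** [J] is a minimal set of coordinates whose nonnegativity implies that of all others on the row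
    space. *)
Lemma exists_irredundant_restrict p q (A : 'M[R]_(p, q)) :
  cone_saturated A ->
  exists J : {set 'I_q},
    [/\ cone_saturated (col_restrict A J), \rank (col_restrict A J) = \rank A
      & irredundant_cols (col_restrict A J)].
Proof.
move=> satA.
pose suff (J : {set 'I_q}) := forall y : 'rV[R]_q, (y <= A)%MS ->
  (forall j, j \in J -> 0 <= y 0 j) -> row_nonneg y.
have exJ : exists J : {set 'I_q}, `[< suff J >].
  by exists [set: 'I_q]; apply/asboolP => y _ y0 j; apply: y0; rewrite in_setT.
have [J /minsetP[/asboolP sJ minJ]] := ex_minset exJ.
exists J; split.
- move=> y1 /submxP[mu e] y10.
  have y0 : row_nonneg (mu *m A).
    apply: sJ => [|j jJ]; first exact: submxMl.
    by have := y10 j; rewrite e /col_restrict mulmxA coord_maskE jJ mulr1.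
  have [lam l0 el] := satA _ (submxMl _ _) y0.
  by exists lam => //; rewrite e /col_restrict !mulmxA el.
- apply/eqP; rewrite eqn_leq mxrankM_maxl /=.
  (* The restriction is injective on the row space: if [v] vanishes on [J], both [v] and [- v] are
     nonnegative. *)
  rewrite -{1}(mxrank_mul_ker A (coord_mask (fun j => j \in J))).
  rewrite (_ : (A :&: _)%MS = 0) ?mxrank0 ?addn0 //.
  apply/eqP/rowV0P => v; rewrite sub_capmx => /andP[vA /sub_kermxP vk].
  have vJ j : j \in J -> v 0 j = 0.
    by move=> jJ; have := coord_maskE (fun j => j \in J) v j;
       rewrite vk jJ mulr1 mxE => <-.
  apply/rowP => j; rewrite mxE; apply/eqP; rewrite eq_le.
  have -> : 0 <= v 0 j by apply: sJ => // k kJ; rewrite vJ.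
  rewrite andbT -oppr_ge0.
  have := sJ (- v); rewrite eqmx_opp => /(_ vA) s.
  by have := s _ j; rewrite mxE; apply => k kJ; rewrite mxE vJ ?oppr0.
- move=> i j; rewrite col_restrictE; case jJ: (j \in J); last by rewrite mulr0 eqxx.
  move=> _.
  have [/asboolP sJ'|/asboolP nsJ] := boolP `[< suff (J :\ j) >].
    have := minJ (J :\ j); rewrite asboolT // => /(_ isT (subD1set _ _)) e.
    by move: jJ; rewrite -e !inE eqxx.
  (* A witness that [J] without [j] is insufficient must be negative at [j], otherwise sufficiency
     of [J] would make it nonnegative. *)
  have [y yA [yJ yn]] : exists2 y : 'rV[R]_q, (y <= A)%MS &
      (forall k, k \in J :\ j -> 0 <= y 0 k) /\ ~ row_nonneg y.
    apply: contrapT => nex; apply: nsJ => y yA yJ.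
    by apply: contrapT => yn; apply: nex; exists y.
  exists (y *m coord_mask (fun j => j \in J)); split.
  + exact: submxMr.
  + rewrite coord_maskE jJ mulr1 ltNge; apply/negP => yj; apply: yn.
    apply: sJ => // k kJ; have [->//|kj] := eqVneq k j.
    by apply: yJ; rewrite !inE kj.
  + move=> k kj; rewrite coord_maskE; case kJ: (k \in J); last by rewrite mulr0.
    by rewrite mulr1 yJ // !inE kj.
Qed.

(** Ratio test: [t] is the minimum of [y 0 j / m 0 j] over the support of [m]. *)
Lemma peel_row q (y m : 'rV[R]_q) :
  row_nonneg y -> row_nonneg m -> m != 0 ->
  exists t j, [/\ 0 <= t, row_nonneg (y - t *: m), m 0 j != 0
                & (y - t *: m) 0 j = 0].
Proof.
move=> y0 m0 mn0.
have [j0 mj0] : exists j, m 0 j != 0.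
  apply/existsP; apply: contraR mn0; rewrite negb_exists => /forallP z.
  by apply/eqP/rowP => j; rewrite mxE; apply/eqP; have := z j; rewrite negbK.
case: (@arg_minP _ _ _ j0 (fun j => m 0 j != 0) (fun j => y 0 j / m 0 j) mj0).
move=> j mj jmin; exists (y 0 j / m 0 j), j; split=> //.
- by rewrite divr_ge0.
- move=> k; rewrite !mxE subr_ge0.
  have [->|mk] := eqVneq (m 0 k) 0; first by rewrite mulr0.
  by rewrite -ler_pdivlMr ?jmin // lt_def mk m0.
- by rewrite !mxE divfK ?subrr.
Qed.

(** Equality of ranks is not known in advance for corresponding faces, hence the two-part
    conclusion. The lower bound on faces of [M1] forces [M1] to have rank [r.+1]; its faces then
    have rank at most [r], which unlocks the saturation half of the induction hypothesis. *)
Lemma cone_saturated_pattern p q (S M : 'M[R]_(p, q)) :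
  (forall i j, 0 <= S i j) -> (forall i j, 0 <= M i j) ->
  (forall i j, (S i j == 0) = (M i j == 0)) -> cone_saturated S ->
  (\rank S <= \rank M)%N /\ ((\rank M <= \rank S)%N -> cone_saturated M).
Proof.
have [r rS] : exists r, \rank S = r by exists (\rank S).
elim: r S M rS => [|r IH] S M rS S0 M0 pat satS.
  have SE : S = 0 by apply/eqP; rewrite -mxrank_eq0 rS.
  have -> : M = 0.
    by apply/matrixP => i j; apply/eqP; rewrite mxE -pat SE mxE.
  split; rewrite ?rS // => _ y /submxP[D ->] _; rewrite mulmx0.
  by exists 0; rewrite ?mul0mx // => j; rewrite mxE.
have [J [satS1 rS1 irrS1]] := exists_irredundant_restrict satS.
set S1 := col_restrict S J in satS1 rS1 irrS1.
set M1 := col_restrict M J.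
have S10 i j : 0 <= S1 i j by rewrite col_restrictE mulr_ge0 ?ler0n.
have M10 i j : 0 <= M1 i j by rewrite col_restrictE mulr_ge0 ?ler0n.
have pat1 i j : (S1 i j == 0) = (M1 i j == 0).
  by rewrite !col_restrictE !mulf_eq0 pat.
have rM1 : (\rank M1 <= \rank M)%N by exact: mxrankM_maxl.
have facet i j : M1 i j != 0 ->
    [/\ (r <= \rank (row_face M1 j))%N &
        (\rank (row_face M1 j) <= r)%N -> cone_saturated (row_face M1 j)].
  move=> Mij; have Sij : S1 i j != 0 by rewrite pat1.
  have rF : \rank (row_face S1 j) = r.
    apply/eqP; rewrite eqn_leq -ltnS -rS -rS1 (rank_row_face_lt Sij) /=.
    rewrite -ltnS -rS -rS1; apply: (rank_row_face_ge Sij).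
    exact: (irredundant_facet S10 satS1 irrS1 Sij).
  have [] := IH (row_face S1 j) (row_face M1 j) rF.
  - by move=> k l; rewrite row_faceE mulr_ge0 ?ler0n.
  - by move=> k l; rewrite row_faceE mulr_ge0 ?ler0n.
  - by move=> k l; rewrite !row_faceE !mulf_eq0 !pat1.
  - exact: cone_saturated_row_face.
  by rewrite rF.
have [i [j0 Mij0]] : exists i j, M1 i j != 0.
  have S1n0 : S1 != 0 by rewrite -mxrank_eq0 rS1 rS.
  apply: contrapT => nex; move/negP: S1n0; apply; apply/eqP/matrixP => i j.
  rewrite [RHS]mxE; apply/eqP; rewrite pat1; apply/negPn/negP => Mij.
  by apply: nex; exists i, j.
have rM1S : (r < \rank M1)%N.
  have [le _] := facet i j0 Mij0.
  exact: leq_ltn_trans le (rank_row_face_lt Mij0).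
rewrite rS; split; first exact: leq_trans rM1S rM1.
move=> rM y /submxP[mu yE] y0.
have eM1 : \rank M1 = r.+1.
  by apply/eqP; rewrite eqn_leq rM1S (leq_trans rM1 rM).
have eM : \rank M = r.+1.
  by apply/eqP; rewrite eqn_leq rM (leq_trans rM1S rM1).
(* [M] and [M1] have equal rank, hence the same left kernel: identities between row combinations may
   be checked on the columns in [J]. *)
have inj (v : 'rV[R]_p) : v *m M1 = 0 -> v *m M = 0.
  move=> vM1; apply/eqP; move/eqP: vM1.
  rewrite -!sub_kermx => /submx_trans; apply.
  have kk : (kermx M <= kermx M1)%MS.
    by rewrite sub_kermx /M1 /col_restrict mulmxA mulmx_ker mul0mx.
  by rewrite -(geq_leqif (mxrank_leqif_sup kk)) !mxrank_ker eM eM1.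
have [] := @peel_row _ (mu *m M1) (row i M1).
- rewrite /M1 /col_restrict mulmxA -yE; exact: row_nonneg_mask.
- by move=> k; rewrite mxE.
- by apply/eqP => /rowP/(_ j0); rewrite mxE [RHS]mxE; apply/eqP.
move=> t [j []]; rewrite mxE.
set y' := _ - _ => t0 y'0 Mij y'j.
have [le satF] := facet i j Mij.
have rF : (\rank (row_face M1 j) <= r)%N.
  by rewrite -ltnS -eM1 (rank_row_face_lt Mij).
have y'F : (y' <= row_face M1 j)%MS.
  apply: (submx_row_face Mij) => //; first by rewrite eM1.
  by rewrite addmx_sub ?eqmx_opp ?scalemx_sub ?submxMl ?row_sub.
have [lam l0 el] := satF rF y' y'F y'0.
(* The mask moves the zeroing of rows off the face from the matrix to the coefficients; [t] is the
   weight of the peeled row [i]. *)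
pose nu : 'rV[R]_p :=
  lam *m coord_mask (fun i => M1 i j == 0) + t *: delta_mx 0 i.
exists nu.
  move=> k; rewrite mxE addr_ge0 ?row_nonneg_mask //.
  by rewrite !mxE mulr_ge0 ?ler0n.
apply/eqP; rewrite yE -subr_eq0 -mulmxBl; apply/eqP/inj.
rewrite mulmxBl mulmxDl -mulmxA -/(row_face M1 j) -el -scalemxAl -rowE.
by rewrite /y' subrK subrr.
Qed.

End ConeSaturation.

(** * Passage between polytopes and saturated cones by homogenisation *)

Section SlackCone.
Variable R : realType.

Lemma conv_rowsP m n (V : 'M[R]_(m, n)) (x : 'rV[R]_n) :
  conv_rows V x <->
  exists2 lam : 'rV[R]_m, row_nonneg lam &
    row_mx (const_mx 1 : 'cV[R]_1) x = lam *m row_mx (const_mx 1) V.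
Proof.
have sumE (lam : 'rV[R]_m) :
    (lam *m (const_mx 1 : 'cV[R]_m)) 0 0 = \sum_i lam 0 i.
  by rewrite mxE; apply: eq_bigr => i _; rewrite mxE mulr1.
split=> [[lam [l0 [l1 xE]]]|[lam l0]]; first exists lam => //.
  rewrite mul_mx_row -xE; congr row_mx.
  by apply/matrixP => i j; rewrite !ord1 sumE l1 mxE.
rewrite mul_mx_row => /eq_row_mx[e ->]; exists lam; split=> //; split=> //.
by rewrite -sumE -e mxE.
Qed.

Lemma conv_rows_row m n (V : 'M[R]_(m, n)) i : conv_rows V (row i V).
Proof.
apply/conv_rowsP; exists (delta_mx 0 i); first by move=> j; rewrite mxE ler0n.
rewrite -rowE row_row_mx; congr row_mx.
by apply/matrixP => k l; rewrite !mxE.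
Qed.

Lemma rank_conv_rows m n (V : 'M[R]_(m, n)) k (X : 'M[R]_(k, n)) :
  (forall i, conv_rows V (row i X)) ->
  (\rank (row_mx (const_mx 1%R : 'cV[R]_k) X) <=
   \rank (row_mx (const_mx 1%R : 'cV[R]_m) V))%N.
Proof.
move=> VX; apply/mxrankS/row_subP => i.
have /conv_rowsP[lam _ e] := VX i.
rewrite row_row_mx (_ : row i (const_mx 1) = const_mx 1) ?e ?submxMl //.
by apply/matrixP => a b; rewrite !mxE.
Qed.

(** Homogenised points of [P] lie in the row space of [[1, V]], so the generators themselves attain
    the maximal rank. *)
Lemma poly_dim_conv_rows n (P : 'rV[R]_n -> Prop) m (V : 'M[R]_(m, n)) d :
  (forall x, P x <-> conv_rows V x) ->
  poly_dim P d <-> \rank (row_mx (const_mx 1 : 'cV[R]_m) V) = d.+1.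
Proof.
move=> PV; split=> [[[k [X [PX rX]]] max]|rV].
  apply/eqP; rewrite eqn_leq max => [|i]; last exact/PV/conv_rows_row.
  by rewrite -rX rank_conv_rows // => i; apply/PV.
split; first by exists m, V; split=> // i; apply/PV/conv_rows_row.
by move=> k X PX; rewrite -rV rank_conv_rows // => i; apply/PV.
Qed.

Lemma conv_rows_no_ray m n (V : 'M[R]_(m, n)) (x u : 'rV[R]_n) :
  (forall t, 0 <= t -> conv_rows V (x + t *: u)) -> u = 0.
Proof.
move=> ray; apply/rowP => k; rewrite mxE; apply/eqP/negPn/negP => uk.
pose B := \sum_i `|V i k|.
have B0 : 0 <= B by rewrite sumr_ge0.
have bnd y : conv_rows V y -> `|y 0 k| <= B.
  case=> lam [l0 [l1 ->]]; rewrite mxE; apply: le_trans (ler_norm_sum _ _ _) _.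
  apply: ler_sum => i _; rewrite normrM ler_piMl // ger0_norm // -l1.
  by rewrite (bigD1 i) //= lerDl sumr_ge0.
(* Chosen so that the step along [u] has size [B + |x_k| + 1] in coordinate [k], which leaves the
   bound [B] even after starting from [x]. *)
pose t := (B + `|x 0 k| + 1) / `|u 0 k|.
have t0 : 0 <= t by rewrite divr_ge0 // !addr_ge0.
have := bnd _ (ray t t0); rewrite !mxE leNgt => /negP; apply.
have e : `|t * u 0 k| = B + `|x 0 k| + 1.
  by rewrite normrM (ger0_norm t0) divfK ?normr_eq0.
have := ler_normB (x 0 k + t * u 0 k) (x 0 k).
rewrite [x 0 k + _]addrC addrK e => le.
have := le_lt_trans (lexx (B + `|x 0 k|)) (ltr_pwDr ltr01 (lexx _)).
by move/lt_le_trans/(_ le); rewrite ltrD2r.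
Qed.

(** If all points coincided, the rows of [[1, V]] would be equal and its rank at most 1. *)
Lemma two_points n (P : 'rV[R]_n -> Prop) m (V : 'M[R]_(m, n)) d :
  (forall x, P x <-> conv_rows V x) -> poly_dim P d -> (1 <= d)%N ->
  exists x y, [/\ P x, P y & x != y].
Proof.
move=> PV /(poly_dim_conv_rows _ PV) rV d1.
apply: contrapT => nex.
have eqP2 x y : P x -> P y -> x = y.
  by move=> Px Py; apply/eqP/negPn/negP => ne; apply: nex; exists x, y.
case: m V PV rV => [|m] V PV rV.
  by move: (rank_leq_row (row_mx (const_mx 1 : 'cV[R]_0) V)); rewrite rV.
have sub : (row_mx (const_mx 1) V <= row 0 (row_mx (const_mx 1 : 'cV[R]_m.+1) V))%MS.
  apply/row_subP => i; rewrite !row_row_mx.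
  have -> : row i V = row 0 V by apply: eqP2; apply/PV/conv_rows_row.
  suff -> : row i (const_mx 1 : 'cV[R]_m.+1) = row 0 (const_mx 1 : 'cV[R]_m.+1).
    exact: submx_refl.
  by apply/matrixP => a b; rewrite !mxE.
have := leq_trans (mxrankS sub) (rank_leq_row _).
by rewrite rV ltnS leqn0; case: d d1 {rV}.
Qed.

Lemma slack_rowE n q (W : 'M[R]_(q, n)) (w : 'cV[R]_q) (a : R) (b : 'rV[R]_n) j :
  (row_mx (const_mx a : 'cV[R]_1) b *m (row_mx w (- W))^T) 0 j =
  a * w j 0 - (b *m W^T) 0 j.
Proof.
by rewrite tr_row_mx mul_row_col linearN /= mulmxN !mxE big_ord1 !mxE.
Qed.

Lemma hpolyP n q (W : 'M[R]_(q, n)) (w : 'cV[R]_q) (x : 'rV[R]_n) :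
  hpoly W w x <->
  row_nonneg (row_mx (const_mx 1 : 'cV[R]_1) x *m (row_mx w (- W))^T).
Proof.
by split=> h j; have := h j; rewrite slack_rowE mul1r subr_ge0.
Qed.

(* For x in P, the vector b - a x is a recession direction of P, hence b = a x;
   as P has two points, a = 0. *)
Lemma slack_row_pointed n (P : 'rV[R]_n -> Prop) p q (V : 'M[R]_(p, n))
    (W : 'M[R]_(q, n)) (w : 'cV[R]_q) (a : R) (b : 'rV[R]_n) :
  (forall x, P x <-> conv_rows V x) -> (forall x, P x <-> hpoly W w x) ->
  (exists d, (1 <= d)%N /\ poly_dim P d) -> a <= 0 ->
  row_nonneg (row_mx (const_mx a : 'cV[R]_1) b *m (row_mx w (- W))^T) ->
  a = 0 /\ b = 0.
Proof.
move=> PV PW [d [d1 dimP]] a0 ab0.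
have bE x : P x -> b = a *: x.
  move=> Px; apply/eqP; rewrite -subr_eq0; apply/eqP.
  apply: (@conv_rows_no_ray _ _ V x) => t t0; apply/PV/PW => j.
  have := ab0 j; rewrite slack_rowE subr_ge0 => bj.
  have /PW/(_ j) xj := Px.
  rewrite mulmxDl -scalemxAl mulmxBl -scalemxAl.
  move: xj bj; move: (x *m W^T) (b *m W^T) => X Y xj bj.
  rewrite !mxE -[leRHS]addr0 lerD // mulr_ge0_le0 // subr_le0.
  by apply: le_trans bj _; rewrite ler_wnM2l.
have [x [y [Px Py xy]]] := two_points PV dimP d1.
have : a *: (x - y) == 0 by rewrite scalerBr -(bE x Px) -(bE y Py) subrr.
rewrite scaler_eq0 subr_eq0 (negbTE xy) orbF => /eqP az.
by split=> //; rewrite (bE x Px) az scale0r.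
Qed.

Lemma row_mx_head n (y : 'rV[R]_(1 + n)) :
  y = row_mx (const_mx (lsubmx y 0 0)) (rsubmx y).
Proof.
rewrite -[LHS]hsubmxK; congr row_mx.
by apply/matrixP => i j; rewrite !ord1 [RHS]mxE.
Qed.

(** A left kernel vector has zero, hence nonnegative, slack; up to sign its head is nonpositive, and
    pointedness kills it. *)
Lemma slack_right_free n (P : 'rV[R]_n -> Prop) p q (V : 'M[R]_(p, n))
    (W : 'M[R]_(q, n)) (w : 'cV[R]_q) :
  (forall x, P x <-> conv_rows V x) -> (forall x, P x <-> hpoly W w x) ->
  (exists d, (1 <= d)%N /\ poly_dim P d) -> row_free (row_mx w (- W))^T.
Proof.
move=> PV PW dimP; rewrite -kermx_eq0; apply/rowV0P => v /sub_kermxP vB.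
wlog v0 : v vB / lsubmx v 0 0 <= 0.
  move=> H; have [/H->//|v0] := lerP (lsubmx v 0 0) 0.
  apply/oppr_inj; rewrite oppr0; apply: H; first by rewrite mulNmx vB oppr0.
  by rewrite linearN mxE oppr_le0 ltW.
have [] := slack_row_pointed PV PW dimP v0 (b := rsubmx v).
  by move=> j; rewrite -row_mx_head vB mxE.
by move=> e1 e2; rewrite (row_mx_head v) e1 e2 -row_mx0; congr row_mx.
Qed.

(** Write [y] as the slack of a vector [(a, b)]. Pointedness settles [a <= 0]; for [a > 0] the point
    [a^-1 *: b] lies in [P], and its convex coefficients are scaled by [a]. *)
Lemma slack_cone_saturated n (P : 'rV[R]_n -> Prop) p q (S : 'M[R]_(p, q)) :
  is_slack_matrix P S -> cone_saturated S.
Proof.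
case=> dimP [V [W [w [PV [PW SE]]]]] y; rewrite SE => /submxP[mu].
rewrite mulmxA (row_mx_head (mu *m _)); set a := lsubmx _ 0 0.
set b := rsubmx _ => yE y0; have [a0|a0] := lerP a 0.
  have [] := slack_row_pointed (a := a) (b := b) PV PW dimP a0.
    by rewrite -yE.
  move=> az bz; exists 0; first by move=> i; rewrite mxE.
  rewrite yE az bz mul0mx (_ : row_mx _ _ = 0) ?mul0mx // -row_mx0.
  by congr row_mx.
have rowE : row_mx (const_mx a : 'cV[R]_1) b =
            a *: row_mx (const_mx 1 : 'cV[R]_1) (a^-1 *: b).
  rewrite scale_row_mx scalerA divff ?gt_eqF // scale1r; congr row_mx.
  by apply/matrixP => i j; rewrite !mxE mulr1.
have : P (a^-1 *: b).
  apply/PW/hpolyP => j; have := y0 j.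
  by rewrite yE rowE -scalemxAl mxE pmulr_rge0.
case/PV/conv_rowsP => lam l0 e; exists (a *: lam).
  by move=> i; rewrite mxE mulr_ge0 // ltW.
by rewrite yE rowE e -!scalemxAl mulmxA.
Qed.

Lemma slack_nonneg n (P : 'rV[R]_n -> Prop) p q (S : 'M[R]_(p, q)) :
  is_slack_matrix P S -> forall i j, 0 <= S i j.
Proof.
case=> dimP [V [W [w [PV [PW ->]]]]] i j.
have /PW/hpolyP/(_ j) : P (row i V) by apply/PV/conv_rows_row.
rewrite (_ : row_mx _ _ = row i (row_mx (const_mx 1) V)); last first.
  by rewrite row_row_mx; congr row_mx; apply/matrixP => a b; rewrite !mxE.
by rewrite -row_mul mxE.
Qed.

Lemma rank_slack n (P : 'rV[R]_n -> Prop) p q (S : 'M[R]_(p, q)) d :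
  is_slack_matrix P S -> poly_dim P d -> \rank S = d.+1.
Proof.
case=> dimP [V [W [w [PV [PW ->]]]]] /(poly_dim_conv_rows _ PV) <-.
by rewrite mxrankMfree // (slack_right_free PV PW).
Qed.

(** A right inverse of the row-free factor recovers the first column of [[1, V]]. *)
Lemma slack_ones n (P : 'rV[R]_n -> Prop) p q (S : 'M[R]_(p, q)) :
  is_slack_matrix P S -> exists x : 'cV[R]_q, S *m x = const_mx 1.
Proof.
case=> dimP [V [W [w [PV [PW ->]]]]].
have /row_freeP[B' BB'] := slack_right_free PV PW dimP.
exists (B' *m col_mx 1%:M 0).
by rewrite -mulmxA (mulmxA _ B') BB' mul1mx mul_row_col mulmx1 mulmx0 addr0.
Qed.

(** In the Gaussian decomposition of [c^T] the left factor is a scalar, so [c] is that multiple of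
    the first column of the transposed right factor. *)
Lemma complete_col n (c : 'cV[R]_(1 + n)) :
  c != 0 -> exists2 G : 'M[R]_(1 + n), G \in unitmx & lsubmx G = c.
Proof.
move=> c0; have rc : \rank c^T = 1%N by rewrite rank_rV -trmx0 (inj_eq trmx_inj) c0.
pose L := col_ebase c^T; pose U := row_ebase c^T.
have cE : c^T = L *m pid_mx 1 *m U by rewrite -{1}(mulmx_ebase c^T) rc.
have LE : L = (L 0 0)%:M by exact: mx11_scalar.
exists (L 0 0 *: U^T).
  have l0 : L 0 0 \is a GRing.unit.
    by have := col_ebase_unit c^T; rewrite -/L LE unitmxE det_scalar1 -LE.
  by rewrite unitmxZ // unitmx_tr row_ebase_unit.
apply: trmx_inj; rewrite cE [in RHS]LE mul_scalar_mx -scalemxAl.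
rewrite linearZ /= linearZ /= trmx_lsub trmxK; congr (_ *: _).
rewrite -[in RHS](vsubmxK U) (_ : pid_mx 1 = row_mx 1%:M 0).
  by rewrite mul_row_col mul1mx mul0mx addr0.
by rewrite pid_mx_row.
Qed.

(** For a rank factorization [C *m D], the vector [D *m x] is sent to the all-ones vector by [C]; a
    change of basis with first column [D *m x] makes it the first column of the left factor. *)
Lemma slack_factorization p q (M : 'M[R]_(p, q)) n :
  \rank M = n.+1 -> (exists x : 'cV[R]_q, M *m x = const_mx 1) -> (0 < p)%N ->
  exists (V : 'M[R]_(p, n)) (B : 'M[R]_(1 + n, q)),
    [/\ M = row_mx (const_mx 1) V *m B, row_full (row_mx (const_mx 1 : 'cV[R]_p) V)
      & row_free B].
Proof.
move=> rM [x Mx] p0.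
have [C [D [ME fC fD]]] : exists (C : 'M[R]_(p, 1 + n)) (D : 'M[R]_(1 + n, q)),
    [/\ M = C *m D, row_full C & row_free D].
  have: M = col_base M *m row_base M by rewrite mulmx_base.
  have := col_base_full M; have := row_base_free M.
  move: (col_base M) (row_base M); rewrite rM => C D fD fC ME.
  by exists C, D.
have Dx0 : D *m x != 0.
  apply/eqP => Dx; have /matrixP/(_ (Ordinal p0) 0) := Mx.
  by rewrite ME -mulmxA Dx mulmx0 !mxE => /esym/eqP; rewrite oner_eq0.
have [G uG GE] := complete_col Dx0.
have CG : C *m G = row_mx (const_mx 1) (rsubmx (C *m G)).
  rewrite -[LHS]hsubmxK; congr row_mx.
  by rewrite -mulmx_lsub GE mulmxA -ME.
exists (rsubmx (C *m G)), (invmx G *m D); rewrite -CG; split.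
- by rewrite -mulmxA mulKVmx.
- by rewrite /row_full mxrankMfree // row_free_unit.
- by rewrite /row_free eqmxMfull // row_full_unit unitmx_inv.
Qed.

Lemma cone_saturated_slack p q (M : 'M[R]_(p, q)) :
  (forall i j, 0 <= M i j) -> (2 <= \rank M)%N -> cone_saturated M ->
  (exists x : 'cV[R]_q, M *m x = const_mx 1) -> is_slack_of_some_polytope M.
Proof.
move=> M0 rM satM ones.
have p0 : (0 < p)%N by apply: leq_trans (rank_leq_row M); apply: ltnW.
have [n rn] : exists n, \rank M = n.+1.
  by exists (\rank M).-1; rewrite prednK // ltnW.
have [V [B [ME fV fB]]] := slack_factorization rn ones p0.
pose w : 'cV[R]_q := lsubmx B^T; pose W := - rsubmx B^T.
have BE : B = (row_mx w (- W))^T by rewrite opprK hsubmxK trmxK.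
exists n, (conv_rows V); split; first by exists p, V.
have rV : \rank (row_mx (const_mx 1 : 'cV[R]_p) V) = n.+1 by apply/eqP.
split.
  by exists n; split; [rewrite -ltnS -rn | exact/(poly_dim_conv_rows (V := V))].
exists V, W, w; split=> //; split; last by rewrite -BE.
move=> x; split=> [/conv_rowsP[lam l0 e]|/hpolyP].
  apply/hpolyP; rewrite -BE e -mulmxA -ME => j; rewrite mxE sumr_ge0 // => i _.
  exact: mulr_ge0.
rewrite -BE; set z := row_mx _ x => zB.
(* Full row rank of [[1, V]] places the slack of any [x] in the row space of [M], where saturation
   applies; row-freeness of [B] then cancels it. *)
have /submxP[mu zE] : (z <= row_mx (const_mx 1 : 'cV[R]_p) V)%MS by exact: submx_full.
have [lam l0 e] : exists2 lam : 'rV[R]_p, row_nonneg lam & z *m B = lam *m M.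
  by apply: satM => //; rewrite zE -mulmxA -ME submxMl.
apply/conv_rowsP; exists lam => //; apply: (row_free_inj fB).
by rewrite e {1}ME mulmxA.
Qed.

End SlackCone.

Theorem theorem4p1 (R : realType) (p q : nat) (M : 'M[R]_(p, q)) :
  (forall i j, 0 <= M i j) -> (2 <= \rank M)%N ->
  (is_slack_of_some_polytope M <->
   (is_incidence_of_dim R (inc_mx M) (\rank M).-1 /\
    exists x : 'cV[R]_q, M *m x = const_mx 1)).
Proof.
move=> M0 rM; split=> [[n [P [polP slP]]]|[[n [P [S [_ [dimP [slS incS]]]]]] ones]].
  split; last exact: slack_ones slP.
  exists n, P, M; split=> //; split=> //.
  have [[d [_ dimP]] _] := slP.
  by rewrite (rank_slack slP dimP).
(* [2 <= \rank M] ensures that the successor of the truncated predecessor is the rank itself. *)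
have rS : \rank S = \rank M by rewrite (rank_slack slS dimP) prednK // ltnW.
apply: cone_saturated_slack => //.
have [||_] := cone_saturated_pattern (slack_nonneg slS) M0.
- by move=> i j; have /matrixP/(_ i j) := incS; rewrite !mxE.
- exact: slack_cone_saturated slS.
by apply; rewrite rS.
Qed.
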